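(* Let $\psi=f+h$ with $f:\mathbb{R}^n\to\mathbb{R}$ continuously differentiable, $h(x)=\gamma\|x\|_1$, $\gamma>0$. Suppose that the basic assumption (see context) holds: the sublevel sets of $\psi$ are bounded, in particular $\mathcal{L}_\psi(x_0)=\{x\mid\psi(x)\le\psi(x_0)\}$ is bounded, and $\nabla f$ is $L_g$-Lipschitz on a convex open set $\mathcal{N}$ containing $\mathcal{L}_\psi(x_0)$ and the trial points of the Two-Metric Adaptive Projection algorithm (TMAP). Let $\{x_k\}$ be the sequence generated by TMAP from $x_0$, and suppose that the sequence does not contain a stationary point ($\mu_k>0$ for all $k$). Then any limit point $x^*$ of $\{x_k\}$ is a stationary point, i.e. $0\in\nabla f(x^* )+\partial h(x^* )$.
   Context: Notation: $\|\cdot\|$ is the Euclidean norm (operator norm for matrices); $x^i$ is the $i$th component of $x$; $\nabla_i f$ the $i$th component of $\nabla f$; $[a]_{I}$ is the subvector of $a$ indexed by $I$. For $\alpha>0$, $\operatorname{prox}_{\alpha h}(x)=\arg\min_u\{\alpha h(u)+\frac12\|u-x\|^2\}$, which for $h=\gamma\|\cdot\|_1$ is componentwise soft-thresholding at level $\alpha\gamma$. A point $x$ is stationary if $0\in\nabla f(x)+\partial h(x)$. TMAP algorithm. Parameters: $\epsilon>0$, $\sigma,\beta,\tau,\delta\in(0,1)$, $c>0$, $\lambda_H>0$, initial point $x_0$. At iteration $k$ let $g_k=\nabla f(x_k)$, $\pi_k=\|x_k-\operatorname{prox}_h(x_k-g_k)\|$, $\epsilon_k=\min\{\epsilon,\pi_k\}$.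 (Index sets) $I_k^{-+}=\{i: x_k^i>\epsilon_k\}\cup\{i:0\le x_k^i\le\epsilon_k,\ g_k^i\le-\gamma\}$; $I_k^{--}=\{i: x_k^i<-\epsilon_k\}\cup\{i:-\epsilon_k\le x_k^i\le 0,\ g_k^i\ge\gamma\}$; $I_k^-=I_k^{-+}\cup I_k^{--}$; $I_k^+=\{1,\dots,n\}\setminus I_k^-$. (Direction) $\omega_k\in\mathbb{R}^n$ has $\omega_k^i=\gamma$ for $i\in I_k^{-+}$, $-\gamma$ for $i\in I_k^{--}$, $0$ for $i\in I_k^+$. Let $\mu_k=c\,\big(\|[x_k-\operatorname{prox}_h(x_k-g_k)]_{I_k^+}\|^2+\|[g_k+\omega_k]_{I_k^-}\|^2\big)^{\delta/2}$. $H_k$ is a symmetric positive semidefinite $|I_k^-|\times|I_k^-|$ matrix with $\|H_k\|\le\lambda_H$. Write $\bar g_k,\bar\omega_k,\bar p_k,\bar r_k$ for the subvectors indexed by $I_k^-$. The direction $p_k$ satisfies $p_k^i=g_k^i$ for $i\in I_k^+$ and $\bar p_k=(H_k+\mu_k I)^{-1}(\bar g_k+\bar\omega_k+\bar r_k)$ for some residual $\bar r_k$ with $\|\bar r_k\|\le\tau\min\{\mu_k\|\bar p_k\|,\|\bar g_k+\bar\omega_k\|\}$. (Trial points) For $t>0$, $x_k(t)$ is defined by: $x_k^i(t)=\max\{x_k^i-tp_k^i,0\}$ for $i\in I_k^{-+}$; $x_k^i(t)=\min\{x_k^i-tp_k^i,0\}$ for $i\in I_k^{--}$; $x_k^i(t)=\operatorname{prox}_{t\gamma|\cdot|}(x_k^i-tp_k^i)$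 for $i\in I_k^+$. With the superscript $+$ denoting subvectors indexed by $I_k^+$, let $G_t(x_k^+;g_k^+)=(x_k^+-x_k^+(t))/t$. (Linesearch) $t_k$ is the first element of $1,\beta,\beta^2,\dots$ with $\psi(x_k)-\psi(x_k(t_k))\ge\sigma t_k(1-\tau)\mu_k\|\bar p_k\|^2+\sigma t_k\|G_{t_k}(x_k^+;g_k^+)\|^2$; then $x_{k+1}=x_k(t_k)$. The linesearch trial points are the points $x_k(\beta^j)$, $k,j\ge 0$. *)

(* Defs.v *)
From HB Require Import structures.
From mathcomp Require Import all_boot all_order all_algebra.
From mathcomp Require Import all_classical all_reals all_analysis.

Set Implicit Arguments.
Unset Strict Implicit.
Unset Printing Implicit Defensive.

Import Order.TTheory GRing.Theory Num.Theory.
Import numFieldNormedType.Exports.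

Local Open Scope classical_set_scope.
Local Open Scope ring_scope.

Section Euclidean.
Context {R : realType}.

Definition dotv n (u v : 'cV[R]_n) : R := \sum_(i < n) u i 0 * v i 0.

(* The library norm on matrices is the sup norm (it induces the same topology
   and the same bounded sets); every metric quantity below uses this one. *)
Definition enorm n (v : 'cV[R]_n) : R := Num.sqrt (\sum_(i < n) v i 0 ^+ 2).

Definition opnorm n (A : 'M[R]_n) : R :=
  sup [set enorm (A *m v) | v in [set v : 'cV[R]_n | enorm v <= 1]].

Definition psd n (A : 'M[R]_n) : Prop :=
  forall v : 'cV[R]_n, 0 <= dotv v (A *m v).

Definition subvec n (I : {set 'I_n}) (a : 'cV[R]_n) : 'cV[R]_#|I| :=
  \col_(j < #|I|) a (enum_val j) 0.

Definition grad n (f : 'cV[R]_n -> R) (x : 'cV[R]_n) : 'cV[R]_n :=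
  \col_(i < n) 'd f x (delta_mx i 0).

(* An arbitrary point if F has no minimizer; the functions minimized below are
   continuous, strongly convex and coercive, hence have exactly one. *)
Definition argmin (T : pointedType) (F : T -> R) : T :=
  get [set u | forall v, F u <= F v].

(* The scaled operator prox_{alpha h} is [prox (fun u => alpha * h u)]. *)
Definition prox n (h : 'cV[R]_n -> R) (x : 'cV[R]_n) : 'cV[R]_n :=
  argmin (fun u => h u + enorm (u - x) ^+ 2 / 2).

Definition prox1 (h : R -> R) (a : R) : R :=
  argmin (fun u : R => h u + `|u - a| ^+ 2 / 2).

Definition subdiff n (h : 'cV[R]_n -> R) (x : 'cV[R]_n) : set 'cV[R]_n :=
  [set v | forall y, h x + dotv v (y - x) <= h y].

Definition stationary n (f h : 'cV[R]_n -> R) (x : 'cV[R]_n) : Prop :=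
  [set grad f x + v | v in subdiff h x] 0.

Definition l1reg n (gamma : R) (x : 'cV[R]_n) : R :=
  gamma * \sum_(i < n) `|x i 0|.

End Euclidean.

Record tmap_param (R : realType) := TmapParam {
  tm_eps : R;
  tm_sigma : R;
  tm_beta : R;
  tm_tau : R;
  tm_delta : R;
  tm_c : R;
  tm_lamH : R;
  tm_eps_gt0 : 0 < tm_eps;
  tm_sigma01 : 0 < tm_sigma < 1;
  tm_beta01 : 0 < tm_beta < 1;
  tm_tau01 : 0 < tm_tau < 1;
  tm_delta01 : 0 < tm_delta < 1;
  tm_c_gt0 : 0 < tm_c;
  tm_lamH_gt0 : 0 < tm_lamH }.

Section TMAP.
Context {R : realType} {n : nat}.
Variables (f : 'cV[R]_n -> R) (gamma : R) (P : tmap_param R).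
Implicit Types (x p : 'cV[R]_n) (t : R).

Local Notation h := (l1reg gamma).
Local Notation g := (grad f).

Definition objective x : R := f x + h x.

Definition sublevel (a : R) : set 'cV[R]_n := [set x | objective x <= a].

Definition prox_residual x : 'cV[R]_n := x - prox h (x - g x).

Definition eps_at x : R := Num.min (tm_eps P) (enorm (prox_residual x)).

(* I^{-+}, I^{--}, I^- and I^+ at x; the first two are disjoint when gamma > 0 *)
Definition Imp x : {set 'I_n} :=
  [set i | (eps_at x < x i 0)
           || (0 <= x i 0 <= eps_at x) && (g x i 0 <= - gamma)].

Definition Imm x : {set 'I_n} :=
  [set i | (x i 0 < - eps_at x)
           || (- eps_at x <= x i 0 <= 0) && (gamma <= g x i 0)].

Definition Im x : {set 'I_n} := (Imp x :|: Imm x)%SET.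

Definition Ip x : {set 'I_n} := (~: Im x)%SET.

Definition omega x : 'cV[R]_n :=
  \col_(i < n) (if i \in Imp x then gamma
                else if i \in Imm x then - gamma else 0).

Definition mu x : R :=
  tm_c P * (enorm (subvec (Ip x) (prox_residual x)) ^+ 2
            + enorm (subvec (Im x) (g x + omega x)) ^+ 2) `^ (tm_delta P / 2).

Definition is_direction x p : Prop :=
  exists (H : 'M[R]_#|Im x|) (r : 'cV[R]_#|Im x|),
    let pbar := subvec (Im x) p in
    let gw := subvec (Im x) (g x) + subvec (Im x) (omega x) in
    [/\ [/\ H^T = H, psd H & opnorm H <= tm_lamH P],
        enorm r <= tm_tau P * Num.min (mu x * enorm pbar) (enorm gw),
        forall i, i \in Ip x -> p i 0 = g x i 0
      & pbar = invmx (H + (mu x)%:M) *m (gw + r)].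

Definition trial x p t : 'cV[R]_n :=
  \col_(i < n)
    (if i \in Imp x then Num.max (x i 0 - t * p i 0) 0
     else if i \in Imm x then Num.min (x i 0 - t * p i 0) 0
     else prox1 (fun u => t * gamma * `|u|) (x i 0 - t * p i 0)).

Definition Gmap x p t : 'cV[R]_#|Ip x| :=
  t^-1 *: (subvec (Ip x) x - subvec (Ip x) (trial x p t)).

Definition suff_decrease x p t : Prop :=
  tm_sigma P * t * (1 - tm_tau P) * mu x * enorm (subvec (Im x) p) ^+ 2
    + tm_sigma P * t * enorm (Gmap x p t) ^+ 2
  <= objective x - objective (trial x p t).

Definition tmap_step x p (x' : 'cV[R]_n) : Prop :=
  is_direction x p /\
  exists j : nat,
    [/\ suff_decrease x p (tm_beta P ^+ j),
        forall i, (i < j)%N -> ~ suff_decrease x p (tm_beta P ^+ i)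
      & x' = trial x p (tm_beta P ^+ j)].

(* x is the sequence of iterates, p the sequence of directions; the matrices
   H_k and the residuals r_k are existentially quantified in is_direction. *)
Definition tmap_run (x0 : 'cV[R]_n) (x p : nat -> 'cV[R]_n) : Prop :=
  x 0%N = x0 /\ forall k, tmap_step (x k) (p k) (x k.+1).

(* Every point x_k(beta^j), including those past the accepted stepsize. *)
Definition trial_points (x p : nat -> 'cV[R]_n) : set 'cV[R]_n :=
  [set y | exists k j : nat, y = trial (x k) (p k) (tm_beta P ^+ j)].

End TMAP.

(* Main.v *)
(* Near a nonstationary point xstar the prox residual is bounded below by some
   a > 0 and the gradient is bounded, so mu_k stays in a compact interval of
   ]0, +oo[ and the I^- part of p_k is bounded.  For a trial step t <= eps_k / |p_k|
   the model decrease is at least t ((1 - tau) mu_k |p_k|^2 + |G_t|^2), while the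
   error is at most L t^2 (|p_k|^2 + |G_t|^2): the accepted stepsizes are bounded
   below.  As |p_k|^2 + |G_t|^2 also controls the squared prox residual, psi drops
   by a fixed eta > 0 at each iterate near xstar.  If xstar is a limit point, two such
   iterates with values within eta / 2 of psi(xstar) contradict monotonicity. *)
Require Import Defs.
From mathcomp Require Import all_boot all_order all_algebra.
From mathcomp Require Import all_classical all_reals all_analysis.
From mathcomp Require Import ring lra.

Import Order.TTheory GRing.Theory Num.Theory.
Import numFieldNormedType.Exports.

Local Open Scope classical_set_scope.
Local Open Scope ring_scope.

(** * Euclidean inner product, norm and operator norm *)

Section Euclidean_space.
Set Implicit Arguments.
Unset Strict Implicit.
Context {R : realType}.
Implicit Types n : nat.

Lemma enorm_ge0 n (v : 'cV[R]_n) : 0 <= enorm v.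
Proof. exact: sqrtr_ge0. Qed.

Lemma sqr_enorm n (v : 'cV[R]_n) : enorm v ^+ 2 = \sum_(i < n) v i 0 ^+ 2.
Proof. by rewrite sqr_sqrtr// sumr_ge0// => i _; rewrite sqr_ge0. Qed.

Lemma dotvv n (v : 'cV[R]_n) : dotv v v = enorm v ^+ 2.
Proof. by rewrite sqr_enorm; apply: eq_bigr => i _; rewrite expr2. Qed.

Lemma dotvDl n (u v w : 'cV[R]_n) : dotv (u + v) w = dotv u w + dotv v w.
Proof. by rewrite -big_split; apply: eq_bigr => i _; rewrite mxE mulrDl. Qed.

Lemma dotvDr n (u v w : 'cV[R]_n) : dotv w (u + v) = dotv w u + dotv w v.
Proof. by rewrite -big_split; apply: eq_bigr => i _; rewrite mxE mulrDr. Qed.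

Lemma dotvC n (u v : 'cV[R]_n) : dotv u v = dotv v u.
Proof. by apply: eq_bigr => i _; rewrite mulrC. Qed.

Lemma dotvZr n (u v : 'cV[R]_n) (a : R) : dotv u (a *: v) = a * dotv u v.
Proof. by rewrite mulr_sumr; apply: eq_bigr => i _; rewrite mxE mulrCA. Qed.

Lemma dotvZl n (u v : 'cV[R]_n) (a : R) : dotv (a *: u) v = a * dotv u v.
Proof. by rewrite dotvC dotvZr dotvC. Qed.

Lemma enorm_coord_le n (v : 'cV[R]_n) i : `|v i 0| <= enorm v.
Proof.
rewrite -(@ler_pXn2r R 2) ?nnegrE ?enorm_ge0// sqr_enorm real_normK ?num_real//.
rewrite (bigD1 i)//= lerDl sumr_ge0// => j _; exact: sqr_ge0.
Qed.

Lemma enorm_eq0 n (v : 'cV[R]_n) : enorm v = 0 -> v = 0.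
Proof.
move=> v0; apply/matrixP => i j; rewrite !mxE ord1.
by apply/eqP; rewrite -normr_le0 -v0 enorm_coord_le.
Qed.

Lemma enormZ n (a : R) (v : 'cV[R]_n) : enorm (a *: v) = `|a| * enorm v.
Proof.
rewrite /enorm -sqrtr_sqr -sqrtrM ?sqr_ge0// mulr_sumr.
by congr (Num.sqrt _); apply: eq_bigr => i _; rewrite mxE exprMn.
Qed.

Lemma enormN n (v : 'cV[R]_n) : enorm (- v) = enorm v.
Proof. by rewrite -scaleN1r enormZ normrN1 mul1r. Qed.

Lemma dotv_le_enorm n (u v : 'cV[R]_n) : dotv u v <= enorm u * enorm v.
Proof.
have [u0|u_neq0] := eqVneq (enorm u) 0.
  rewrite u0 mul0r (enorm_eq0 u0) /dotv big1// => i _.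
  by rewrite mxE mul0r.
have [v0|v_neq0] := eqVneq (enorm v) 0.
  rewrite v0 mulr0 (enorm_eq0 v0) /dotv big1// => i _.
  by rewrite mxE mulr0.
have uv_gt0 : 0 < enorm u * enorm v.
  by rewrite mulr_gt0// lt_neqAle eq_sym enorm_ge0 ?u_neq0 ?v_neq0.
(* This square expands to 2 |u| |v| (|u| |v| - <u, v>). *)
have : 0 <= enorm (enorm v *: u + (- enorm u) *: v) ^+ 2 by exact: sqr_ge0.
rewrite -dotvv !dotvDl !dotvDr !dotvZl !dotvZr !dotvv (dotvC v u) => sq_ge0.
rewrite -(ler_pM2l uv_gt0); nra.
Qed.

Lemma enormD n (u v : 'cV[R]_n) : enorm (u + v) <= enorm u + enorm v.
Proof.
rewrite -(@ler_pXn2r R 2) ?nnegrE ?addr_ge0 ?enorm_ge0//.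
rewrite -dotvv dotvDl !dotvDr (dotvC v u) !dotvv.
have := dotv_le_enorm u v; nra.
Qed.

Lemma enorm_mulmx_le n (A : 'M[R]_n) (v : 'cV[R]_n) :
  enorm (A *m v) <= opnorm A * enorm v.
Proof.
have [v0|v_neq0] := eqVneq (enorm v) 0.
  rewrite (enorm_eq0 v0) mulmx0.
  have -> : enorm (0 : 'cV[R]_n) = 0 by rewrite -(scale0r v) enormZ normr0 mul0r.
  by rewrite mulr0.
have v_gt0 : 0 < enorm v by rewrite lt_neqAle eq_sym v_neq0 enorm_ge0.
rewrite -ler_pdivrMr//.
have -> : enorm (A *m v) / enorm v = enorm (A *m ((enorm v)^-1 *: v)).
  by rewrite -scalemxAr enormZ ger0_norm ?invr_ge0 ?enorm_ge0// mulrC.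
apply: ub_le_sup; last first.
  exists ((enorm v)^-1 *: v) => //=.
  by rewrite enormZ ger0_norm ?invr_ge0 ?enorm_ge0// mulVf.
(* The supremum is an upper bound only of a bounded set. The entries of [w] are at most 1 in
   absolute value, so the absolute row sums of [A] give a bound. *)
exists (Num.sqrt (\sum_(i < n) (\sum_(j < n) `|A i j|) ^+ 2)) => _ [w /= w_le1 <-].
apply: ler_wsqrtr; apply: ler_sum => i _.
rewrite -real_normK ?num_real// ler_pXn2r ?nnegrE ?sumr_ge0// mxE.
apply: (le_trans (ler_norm_sum _ _ _)); apply: ler_sum => j _.
by rewrite normrM ler_piMr// (le_trans (enorm_coord_le _ _)).
Qed.

Lemma dotv_subvec n (I : {set 'I_n}) (u v : 'cV[R]_n) :
  dotv (subvec I u) (subvec I v) = \sum_(i in I) u i 0 * v i 0.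
Proof. by rewrite big_enum_val; apply: eq_bigr => i _; rewrite !mxE. Qed.

Lemma sqr_enorm_subvec n (I : {set 'I_n}) (v : 'cV[R]_n) :
  enorm (subvec I v) ^+ 2 = \sum_(i in I) v i 0 ^+ 2.
Proof. by rewrite -dotvv dotv_subvec. Qed.

Lemma subvecD n (I : {set 'I_n}) (u v : 'cV[R]_n) :
  subvec I (u + v) = subvec I u + subvec I v.
Proof. by apply/matrixP => i j; rewrite !mxE. Qed.

(** A kernel vector w satisfies 0 = <w, H w> + m |w|^2 with both terms nonnegative, hence w = 0.
    Since [kermx] is a left kernel, the argument goes through transposes. *)
Lemma psd_shift_unitmx n (H : 'M[R]_n) (m : R) :
  psd H -> 0 < m -> H + m%:M \in unitmx.
Proof.
move=> psdH m_gt0; rewrite -unitmx_tr -row_free_unit -kermx_eq0.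
apply/eqP/row_matrixP => i; rewrite row0.
set w := row i _.
have wk : w *m (H + m%:M)^T = 0 by rewrite /w -row_mul mulmx_ker row0.
have Hw : (H + m%:M) *m w^T = 0 by rewrite -[LHS]trmxK trmx_mul trmxK wk trmx0.
have : dotv w^T ((H + m%:M) *m w^T) = 0.
  by rewrite Hw /dotv big1// => j _; rewrite !mxE mulr0.
rewrite mulmxDl mul_scalar_mx dotvDr dotvZr dotvv => eq0.
have : enorm w^T ^+ 2 = 0 by have := psdH w^T; have := sqr_ge0 (enorm w^T); nra.
move=> /eqP; rewrite sqrf_eq0 => /eqP /enorm_eq0 wT0.
by rewrite -[w]trmxK wT0 trmx0.
Qed.

End Euclidean_space.

(** * Scalar soft-thresholding and the proximal maps of the l1 norm *)

Section Soft_thresholding.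
Set Implicit Arguments.
Unset Strict Implicit.
Context {R : realType}.
Implicit Types lam a u g t : R.

Definition soft lam a : R := Num.max (a - lam) 0 + Num.min (a + lam) 0.

(** The second index is the absolute value, so that one case analysis replaces both [soft lam a] and
    its norm. *)
Variant soft_spec lam a : R -> R -> Prop :=
| SoftPos of lam < a : soft_spec lam a (a - lam) (a - lam)
| SoftNeg of a < - lam : soft_spec lam a (a + lam) (- (a + lam))
| SoftZero of - lam <= a <= lam : soft_spec lam a 0 0.

Lemma softP lam a : 0 <= lam -> soft_spec lam a (soft lam a) `|soft lam a|.
Proof.
move=> lam_ge0; rewrite /soft.
have [al|al] := ltP lam a.
  have -> : Num.max (a - lam) 0 = a - lam by rewrite max_l//; lra.
  have -> : Num.min (a + lam) 0 = 0 by rewrite min_r//; lra.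
  rewrite addr0 ger0_norm; last lra.
  exact: SoftPos.
have -> : Num.max (a - lam) 0 = 0 by rewrite max_r//; lra.
rewrite add0r; have [al'|al'] := ltP a (- lam).
  have -> : Num.min (a + lam) 0 = a + lam by rewrite min_l//; lra.
  rewrite ler0_norm; last lra.
  exact: SoftNeg.
have -> : Num.min (a + lam) 0 = 0 by rewrite min_r//; lra.
by rewrite normr0; apply: SoftZero; rewrite al al'.
Qed.

(* Strong convexity of u |-> lam |u| + (u - a)^2 / 2 around its minimizer. *)
Lemma soft_strong_min lam a u : 0 <= lam ->
  lam * `|soft lam a| + (soft lam a - a) ^+ 2 / 2 + (u - soft lam a) ^+ 2 / 2
    <= lam * `|u| + (u - a) ^+ 2 / 2.
Proof.
move=> lam_ge0.
have u1 : u <= `|u| by exact: ler_norm.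
have u2 : - u <= `|u| by rewrite -normrN; exact: ler_norm.
by case: softP => // al; nra.
Qed.

(** [argmin] selects an unspecified minimizer, so uniqueness is what determines its value. *)
Lemma argmin_eq (T : pointedType) (F : T -> R) (s : T) :
  (forall v, F s <= F v) -> (forall v, F v <= F s -> v = s) -> argmin F = s.
Proof.
move=> Fs uniq; apply: uniq.
by apply: (@getPex _ [set v | forall w, F v <= F w]); exists s.
Qed.

Lemma prox1_soft lam a : 0 <= lam -> prox1 (fun u => lam * `|u|) a = soft lam a.
Proof.
move=> lam_ge0; apply: argmin_eq => u; rewrite !real_normK ?num_real//.
  have := soft_strong_min a u lam_ge0; have := sqr_ge0 (u - soft lam a).
  lra.
have := soft_strong_min a u lam_ge0; have := sqr_ge0 (u - soft lam a).
move=> h1 h2 h3; have /eqP : (u - soft lam a) ^+ 2 = 0 by lra.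
by rewrite sqrf_eq0 subr_eq0 => /eqP.
Qed.

(** The minimized function separates over coordinates, so [soft_strong_min] sums up to [key], whose
    last square gives both minimality and uniqueness. *)
Lemma prox_l1reg_soft n (gamma : R) (y : 'cV[R]_n) : 0 <= gamma ->
  prox (l1reg gamma) y = \col_i soft gamma (y i 0).
Proof.
move=> gamma_ge0; set s := (X in _ = X).
have key (u : 'cV[R]_n) :
    l1reg gamma s + enorm (s - y) ^+ 2 / 2 + enorm (u - s) ^+ 2 / 2
      <= l1reg gamma u + enorm (u - y) ^+ 2 / 2.
  rewrite !sqr_enorm /l1reg !mulr_sumr !mulr_suml -!big_split /=.
  apply: ler_sum => i _; rewrite !mxE.
  exact: soft_strong_min.
apply: argmin_eq => u; have := key u; have := sqr_ge0 (enorm (u - s)); first lra.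
move=> h1 h2 h3; have /eqP : enorm (u - s) ^+ 2 = 0 by lra.
by rewrite sqrf_eq0 => /eqP /enorm_eq0 /eqP; rewrite subr_eq0 => /eqP.
Qed.

Lemma soft_residual_le lam a g : 0 <= lam ->
  `|a - soft lam (a - g)| <= `|g| + lam.
Proof.
move=> lam_ge0; have g1 : g <= `|g| by exact: ler_norm.
have g2 : - g <= `|g| by rewrite -normrN; exact: ler_norm.
by rewrite ler_norml; apply/andP; case: softP => // ag; split; lra.
Qed.

(** Strong minimality of the prox point, tested at [a]: the two half squares of the displacement add
    up to a full one. *)
Lemma soft_step_descent lam a g t : 0 < t -> 0 <= lam ->
  g * (soft (t * lam) (a - t * g) - a)
    + (lam * `|soft (t * lam) (a - t * g)| - lam * `|a|)
  <= - t^-1 * (a - soft (t * lam) (a - t * g)) ^+ 2.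
Proof.
move=> t_gt0 lam_ge0.
have tlam_ge0 : 0 <= t * lam by rewrite mulr_ge0// ltW.
have := soft_strong_min (a - t * g) a tlam_ge0.
set s := soft _ _ => smin.
rewrite mulNr lerNr ler_pdivrMl//; nra.
Qed.

(* The step d(t) = soft (t lam) (a - t g) - a has |d(t)| / t nonincreasing in t:
   comparing the two strong minimality inequalities at each other's minimizer
   puts d(1) between d(t) and d(t) / t. *)
Lemma soft_step_mono lam a g t : 0 < t -> t <= 1 -> 0 <= lam ->
  t * `|a - soft lam (a - g)| <= `|a - soft (t * lam) (a - t * g)|.
Proof.
move=> t_gt0 t_le1 lam_ge0.
have tlam_ge0 : 0 <= t * lam by rewrite mulr_ge0// ltW.
have := soft_strong_min (a - t * g) (soft lam (a - g)) tlam_ge0.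
have := soft_strong_min (a - g) (soft (t * lam) (a - t * g)) lam_ge0.
set s := soft lam _; set st := soft _ _ => s_min st_min.
have prod_le0 : ((a - s) - (a - st)) * (t * (a - s) - (a - st)) <= 0 by nra.
rewrite -{1}[t]gtr0_norm// -normrM.
rewrite -[leRHS]ger0_norm// -ler_sqr ?nnegrE// !real_normK ?num_real//.
set d1 := a - s in prod_le0 *; set dt := a - st in prod_le0 *.
rewrite leNgt; apply/negP => dt_lt.
(* The left side is 2 t (d1 - dt) (t d1 - dt), split so that both terms are nonnegative when |dt| <
   |t d1|. Then t d1 = dt, a contradiction. *)
have sq : (1 + t) * (t * d1 - dt) ^+ 2 + (1 - t) * ((t * d1) ^+ 2 - dt ^+ 2) <= 0.
  have : t * ((d1 - dt) * (t * d1 - dt)) <= 0 by rewrite pmulr_rle0.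
  nra.
have /eqP : (t * d1 - dt) ^+ 2 = 0.
  by have := sqr_ge0 (t * d1 - dt); nra.
by rewrite sqrf_eq0 subr_eq0 => /eqP eq_dt; rewrite eq_dt ltxx in dt_lt.
Qed.

End Soft_thresholding.

(** * First-order upper bound from a Lipschitz gradient *)

Section Mean_value.
Set Implicit Arguments.
Unset Strict Implicit.
Context {R : realType} {n : nat}.
Implicit Types (f : 'cV[R]_n -> R) (x y d : 'cV[R]_n).

Lemma diff_grad f x d : differentiable f x -> 'd f x d = dotv (grad f x) d.
Proof.
move=> df; have {1}-> : d = \sum_(i < n) d i 0 *: delta_mx i 0.
  by rewrite [LHS]matrix_sum_delta; apply: eq_bigr => i _; rewrite big_ord1.
rewrite linear_sum; apply: eq_bigr => i _.
by rewrite linearZ mxE mulrC.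
Qed.

(** The one-variable mean value theorem along s |-> x + s (y - x) on [0, 1]. *)
Lemma mean_value f x y : (forall z, differentiable f z) ->
  exists2 s : R, 0 <= s <= 1 &
    f y - f x = dotv (grad f (x + s *: (y - x))) (y - x).
Proof.
move=> df; pose l (s : R) := x + s *: (y - x).
have dl (s : R) : is_diff s l (0 + *:%R ^~ (y - x)).
  exact: (is_diffD (is_diff_cst x s) (is_diff_scalel s (y - x))).
have dF (s : R) : is_derive s 1 (f \o l) (dotv (grad f (l s)) (y - x)).
  have dfl : differentiable (f \o l) s by exact: differentiable_comp.
  apply: DeriveDef; first exact: diff_derivable.
  rewrite deriveE// diff_comp//= diff_val.
  by rewrite -diff_grad//; congr ('d f _ _); rewrite /= fctE/= scale1r add0r.
have cF : {within `[0, 1], continuous (f \o l)}.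
  apply: derivable_within_continuous => s _; exact: ex_derive.
have [s s01] := MVT_segment (ler01 : (0 : R) <= 1) (fun s _ => dF s) cF.
rewrite /= /l scale1r scale0r addr0 subr0 mulr1 subrKC => ->.
by exists s => //; move: s01; rewrite in_itv.
Qed.

(* The mean value theorem gives |L| instead of the sharp L / 2, which only
   changes the lower bound on the stepsizes. *)
Lemma lipschitz_grad_upper_bound f (N : set 'cV[R]_n) (L : R) x y :
  (forall z, differentiable f z) -> convex_set N ->
  (forall u v, N u -> N v -> enorm (grad f u - grad f v) <= L * enorm (u - v)) ->
  N x -> N y ->
  f y - f x <= dotv (grad f x) (y - x) + `|L| * enorm (y - x) ^+ 2.
Proof.
move=> df cN lip Nx Ny; have [s /andP[s0 s1] ->] := mean_value x y df.
set z := x + _.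
have Nz : N z.
  (* The intermediate point is the convex combination s y + (1 - s) x, so the Lipschitz bound on [N]
     applies to it. *)
  have := cN y x (Itv01 s0 s1); rewrite !inE => /(_ Ny Nx).
  by congr N; rewrite /z scalerBr addrCA /conv/= scalerBl scale1r.
rewrite -lerBlDl.
have -> : dotv (grad f z) (y - x) - dotv (grad f x) (y - x)
    = dotv (grad f z - grad f x) (y - x).
  by rewrite dotvDl -(scaleN1r (grad f x)) dotvZl mulN1r.
apply: (le_trans (dotv_le_enorm _ _)); rewrite expr2 mulrA.
apply: ler_wpM2r; first exact: enorm_ge0.
apply: (le_trans (lip _ _ Nz Nx)).
rewrite /z addrAC subrr add0r enormZ ger0_norm//.
have := enorm_ge0 (y - x); have := ler_norm L; have := normr_ge0 L.
move=> L0 LL e0; apply: (@le_trans _ _ (`|L| * (s * enorm (y - x)))).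
  by rewrite ler_wpM2r ?mulr_ge0.
by rewrite ler_wpM2l// ler_piMl.
Qed.

End Mean_value.

(** * Estimates for a single iteration *)

Section Iteration.
Set Implicit Arguments.
Unset Strict Implicit.
Context {R : realType} {n : nat}.
Context (f : 'cV[R]_n -> R) (gamma : R) (P : tmap_param R) (gamma_gt0 : 0 < gamma).
Implicit Types (x p : 'cV[R]_n) (t : R).

Local Notation g := (grad f).
Local Notation res := (prox_residual f gamma).
Local Notation eps := (eps_at f gamma P).
Local Notation Ip := (Ip f gamma P).
Local Notation Im := (Defs.Im f gamma P).
Local Notation omega := (omega f gamma P).
Local Notation mu := (mu f gamma P).
Local Notation trial := (trial f gamma P).
Local Notation Gmap := (Gmap f gamma P).
Local Notation tau := (tm_tau P).
Local Notation sigma := (tm_sigma P).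
Local Notation lamH := (tm_lamH P).

(** The base of the power in [mu], which is c times the power delta / 2 of this quantity. *)
Definition criticality x : R :=
  enorm (subvec (Ip x) (res x)) ^+ 2 + enorm (subvec (Im x) (g x + omega x)) ^+ 2.

Lemma prox_residualE x i :
  res x i 0 = x i 0 - soft gamma (x i 0 - g x i 0).
Proof. by rewrite /prox_residual prox_l1reg_soft ?ltW// !mxE. Qed.

Lemma eps_at_ge0 x : 0 <= eps x.
Proof. by rewrite le_min enorm_ge0 ltW ?tm_eps_gt0. Qed.

Lemma sum_Ip_Im x (F : 'I_n -> R) :
  \sum_(i < n) F i = \sum_(i in Ip x) F i + \sum_(i in Im x) F i.
Proof.
rewrite (bigID (mem (Im x)))/= addrC; congr (_ + _).
by apply: eq_bigl => i; rewrite finset.in_setC.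
Qed.

(** Records why an index is in I^-: either |x_i| > eps, or g_i lies beyond the threshold with sign
    opposite to that of the orthant. The indices let one case analysis fix both [omega] and the
    branch of [trial]. *)
Variant Im_spec x i : R -> bool -> Prop :=
| ImPlus of 0 <= x i 0 & (eps x < x i 0) \/ (g x i 0 <= - gamma) :
    Im_spec x i gamma true
| ImMinus of x i 0 <= 0 & (x i 0 < - eps x) \/ (gamma <= g x i 0) :
    Im_spec x i (- gamma) false.

Lemma ImP x i : i \in Im x ->
  Im_spec x i (omega x i 0) (i \in Imp f gamma P x).
Proof.
move=> iIm; rewrite mxE.
have e0 := eps_at_ge0 x.
case: ifPn => [|iNp].
  rewrite inE => /orP[ex|/andP[/andP[x0 _] gx]]; apply: ImPlus => //.
  - by apply: ltW; apply: le_lt_trans ex.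
  - by left.
  - by right.
move: iIm; rewrite finset.in_setU (negbTE iNp)/= => iIm; rewrite iIm.
move: iIm; rewrite inE => /orP[ex|/andP[/andP[_ x0] gx]]; apply: ImMinus => //.
- by apply: ltW; apply: lt_le_trans ex _; rewrite oppr_le0.
- by left.
- by right.
Qed.

(** In each branch of soft-thresholding the residual entry equals (g + omega)_i or lies between 0
    and it. *)
Lemma prox_residual_le_Im x i : i \in Im x ->
  res x i 0 ^+ 2 <= (g x + omega x) i 0 ^+ 2.
Proof.
move=> iIm; have e0 := eps_at_ge0 x; rewrite prox_residualE [X in _ <= X ^+ 2]mxE.
have g0 := gamma_gt0.
case: (ImP iIm) => [x0|x0] sgn; case: (softP (x i 0 - g x i 0) (ltW g0)) => xg;
  rewrite -subr_ge0 subr_sqr; case: sgn => sgn;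
  first [nra | apply: mulr_ge0; lra | apply: mulr_le0; lra].
Qed.

(** Bounds [mu] below by a quantity free of the index sets, which may jump as x varies. *)
Lemma sqr_prox_residual_le_criticality x : enorm (res x) ^+ 2 <= criticality x.
Proof.
rewrite sqr_enorm (sum_Ip_Im x) /criticality !sqr_enorm_subvec lerD2l.
by apply: ler_sum => i; exact: prox_residual_le_Im.
Qed.

(** The matching upper bound, again free of the index sets. *)
Lemma criticality_le x :
  criticality x <= \sum_(i < n) (`|g x i 0| + gamma) ^+ 2.
Proof.
rewrite /criticality !sqr_enorm_subvec (sum_Ip_Im x).
apply: lerD; apply: ler_sum => i iI.
  rewrite -[leLHS]real_normK ?num_real// ler_pXn2r ?nnegrE ?addr_ge0 ?(ltW gamma_gt0)//.
  by rewrite prox_residualE soft_residual_le// ltW.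
rewrite -[leLHS]real_normK ?num_real// ler_pXn2r ?nnegrE ?addr_ge0 ?(ltW gamma_gt0)//.
rewrite [X in `|X|]mxE (le_trans (ler_normD _ _))// lerD2l.
by case: (ImP iI) => *; rewrite ?normrN gtr0_norm.
Qed.

(** At a fixed point of the prox-gradient map, the square (y_i - x_i)^2 / 2 in the strong minimality
    inequality cancels, leaving exactly the subgradient inequality for - g. *)
Lemma prox_residual0_stationary x : res x = 0 -> stationary f (l1reg gamma) x.
Proof.
move=> res0; exists (- g x); last by rewrite subrr.
move=> y; rewrite /l1reg !mulr_sumr -big_split/=; apply: ler_sum => i _.
have := prox_residualE x i; rewrite res0 [LHS]mxE => /esym/eqP.
rewrite subr_eq0 => /eqP xs.
have := soft_strong_min (x i 0 - g x i 0) (y i 0) (ltW gamma_gt0).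
rewrite -xs [(- g x) i 0]mxE [(y - x) i 0]mxE [(- x) i 0]mxE; nra.
Qed.

(** Both bounds come from gw = (H + mu I) pb - r with |r| <= tau mu |pb|: pair it with pb for the
    first, take norms for the second. *)
Lemma is_direction_bounds x p (pb := subvec (Im x) p)
    (gw := subvec (Im x) (g x + omega x)) :
  0 < mu x -> is_direction f gamma P x p ->
  (1 - tau) * mu x * enorm pb ^+ 2 <= dotv gw pb /\
  enorm gw <= (lamH + 2 * mu x) * enorm pb.
Proof.
move=> mu_gt0 [H [r /= [[_ psdH Hle] rle _]]].
rewrite -subvecD -/gw -/pb => pbE.
have [tau0 tau1] := andP (tm_tau01 P).
have gwE : gw = H *m pb + mu x *: pb - r.
  rewrite -mul_scalar_mx -mulmxDl pbE mulKVmx ?addrK//.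
  exact: psd_shift_unitmx.
have r_le : enorm r <= tau * (mu x * enorm pb).
  by apply: le_trans rle _; rewrite ler_pM2l// ge_min lexx.
have pb0 := enorm_ge0 pb.
split.
  rewrite dotvC gwE !dotvDr dotvZr dotvv -(scaleN1r r) dotvZr.
  have := psdH pb; have := dotv_le_enorm pb r.
  have : enorm pb * enorm r <= enorm pb * (tau * (mu x * enorm pb)).
    by rewrite ler_wpM2l.
  lra.
rewrite gwE (le_trans (enormD _ _))// enormN.
have := enormD (H *m pb) (mu x *: pb); rewrite enormZ gtr0_norm//.
have := enorm_mulmx_le H pb.
have : opnorm H * enorm pb <= lamH * enorm pb by rewrite ler_wpM2r.
have : tau * (mu x * enorm pb) <= mu x * enorm pb.
  by rewrite ler_piMl ?(ltW tau1)// mulr_ge0 ?(ltW mu_gt0).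
lra.
Qed.

Lemma is_direction_Ip x p i : is_direction f gamma P x p ->
  i \in Ip x -> p i 0 = g x i 0.
Proof. by move=> [H [r /= [_ _ + _]]]; apply. Qed.

(* Either the projection onto the orthant is inactive because t |p_i| <= eps, or
   (g + omega)_i has the sign that makes clipping the step harmless. *)
Lemma trial_Im x p t i : 0 < t -> i \in Im x -> t * `|p i 0| <= eps x ->
  g x i 0 * (trial x p t i 0 - x i 0)
     + gamma * (`|trial x p t i 0| - `|x i 0|)
    <= - t * ((g x + omega x) i 0 * p i 0) /\
  (trial x p t i 0 - x i 0) ^+ 2 <= t ^+ 2 * p i 0 ^+ 2.
Proof.
move=> t0 iIm; have -> : t * `|p i 0| = `|t * p i 0| by rewrite normrM gtr0_norm.
rewrite ler_norml => /andP[tp1 tp2].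
have e0 := eps_at_ge0 x.
rewrite -exprMn [(g x + _) i 0]mxE mulNr mulrCA -mulrN.
rewrite [trial x p t i 0]mxE.
(* This form makes the second test of [trial] reduce once membership in I^{-+} is decided. *)
have -> : (i \in Imm f gamma P x) = (i \notin Imp f gamma P x) || (i \in Imm f gamma P x).
  by move: iIm; rewrite finset.in_setU; case: (i \in Imp _ _ _ _).
case: (ImP iIm) => [x0|x0] sgn /=; set q := t * p i 0 in tp1 tp2 *.
  rewrite (ger0_norm x0) ger0_norm ?le_max ?lexx ?orbT//.
  have [xq|xq] := ltP (x i 0 - q) 0.
    by split; case: sgn => sgn; nra.
  by split; nra.
rewrite (ler0_norm x0) ler0_norm ?ge_min ?lexx ?orbT//.
have [xq|xq] := ltP (x i 0 - q) 0.
  by split; nra.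
by split; case: sgn => sgn; nra.
Qed.

Lemma trial_Ip x p t i : is_direction f gamma P x p -> 0 < t -> i \in Ip x ->
  trial x p t i 0 = soft (t * gamma) (x i 0 - t * g x i 0).
Proof.
move=> dir t0 iIp; rewrite mxE (is_direction_Ip dir iIp).
move: iIp; rewrite finset.in_setC finset.in_setU negb_or => /andP[/negbTE-> /negbTE->].
by rewrite prox1_soft// mulr_ge0 ?ltW.
Qed.

Lemma sqr_enorm_Gmap x p t : enorm (Gmap x p t) ^+ 2 =
  t^-1 ^+ 2 * \sum_(i in Ip x) (x i 0 - trial x p t i 0) ^+ 2.
Proof.
rewrite enormZ exprMn real_normK ?num_real//; congr (_ * _).
have -> : subvec (Ip x) x - subvec (Ip x) (trial x p t)
    = subvec (Ip x) (x - trial x p t).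
  by apply/matrixP => i j; rewrite !mxE.
by rewrite sqr_enorm_subvec; apply: eq_bigr => i _; rewrite !mxE.
Qed.

(** Coordinatewise sums: [trial_Im] on I^-, and [soft_step_descent] on I^+, where the displacement
    is -t G_t. *)
Lemma trial_displacement x p t (pb := subvec (Im x) p) (d := trial x p t - x) :
    is_direction f gamma P x p -> 0 < t -> t * enorm pb <= eps x ->
  dotv (g x) d + (l1reg gamma (trial x p t) - l1reg gamma x)
     <= - t * dotv (subvec (Im x) (g x + omega x)) pb
        - t * enorm (Gmap x p t) ^+ 2 /\
  enorm d ^+ 2 <= t ^+ 2 * (enorm pb ^+ 2 + enorm (Gmap x p t) ^+ 2).
Proof.
move=> dir t0 tpb.
have tp i : i \in Im x -> t * `|p i 0| <= eps x.
  move=> iIm; apply: le_trans tpb; rewrite ler_pM2l//.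
  rewrite -(@ler_pXn2r R 2) ?nnegrE ?enorm_ge0// sqr_enorm_subvec.
  by rewrite real_normK ?num_real// (bigD1 i)//= lerDl sumr_ge0// => j _; exact: sqr_ge0.
have tn0 : t != 0 by rewrite gt_eqF.
split.
  rewrite /l1reg -mulrBr -sumrB mulr_sumr -big_split/= (sum_Ip_Im x) addrC.
  apply: lerD.
    rewrite dotv_subvec mulr_sumr; apply: ler_sum => i iIm.
    by rewrite [d i 0]mxE [(- x) i 0]mxE; have [] := trial_Im t0 iIm (tp _ iIm).
  rewrite sqr_enorm_Gmap mulrA expr2 mulrA mulfV// mul1r -mulNr mulr_sumr.
  apply: ler_sum => i iIp.
  rewrite [d i 0]mxE [(- x) i 0]mxE [gamma * _]mulrBr trial_Ip//.
  by apply: soft_step_descent => //; exact: ltW.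
rewrite mulrDr sqr_enorm (sum_Ip_Im x) addrC; apply: lerD.
  rewrite sqr_enorm_subvec mulr_sumr; apply: ler_sum => i iIm.
  by rewrite [d i 0]mxE [(- x) i 0]mxE; have [] := trial_Im t0 iIm (tp _ iIm).
rewrite sqr_enorm_Gmap mulrA -exprMn mulfV// expr1n mul1r.
by apply: ler_sum => i _; rewrite [d i 0]mxE [(- x) i 0]mxE -sqrrN opprB.
Qed.

(* On I^+ the prox-gradient map at step t <= 1 dominates the one at step 1. *)
Lemma criticality_le_step x p t : 0 < mu x -> is_direction f gamma P x p ->
    0 < t -> t <= 1 ->
  criticality x <= enorm (Gmap x p t) ^+ 2
    + (lamH + 2 * mu x) ^+ 2 * enorm (subvec (Im x) p) ^+ 2.
Proof.
move=> mu0 dir t0 t1; have [_ gwle] := is_direction_bounds mu0 dir.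
apply: lerD; last first.
  rewrite -exprMn ler_pXn2r ?nnegrE ?enorm_ge0//.
  exact: le_trans (enorm_ge0 _) gwle.
rewrite sqr_enorm_Gmap sqr_enorm_subvec mulr_sumr; apply: ler_sum => i iIp.
rewrite trial_Ip// prox_residualE -exprMn.
rewrite -[leLHS]real_normK ?num_real// -[leRHS]real_normK ?num_real//.
rewrite ler_pXn2r ?nnegrE// normrM [`|t^-1|]gtr0_norm ?invr_gt0// ler_pdivlMl//.
by apply: soft_step_mono => //; exact: ltW.
Qed.

(** The quadratic error |L| t^2 (|pb|^2 + |G_t|^2) is absorbed by the fraction 1 - sigma of the
    model decrease; the two bounds on [|L| * t] treat the two squares separately. *)
Lemma suff_decrease_small_step (N : set 'cV[R]_n) (L : R) x p t
    (pb := subvec (Im x) p) :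
    (forall z, differentiable f z) -> convex_set N ->
    (forall u v, N u -> N v -> enorm (g u - g v) <= L * enorm (u - v)) ->
    N x -> N (trial x p t) -> 0 < mu x -> is_direction f gamma P x p ->
    0 < t -> t * enorm pb <= eps x ->
    `|L| * t <= (1 - sigma) * ((1 - tau) * mu x) -> `|L| * t <= 1 - sigma ->
  suff_decrease f gamma P x p t.
Proof.
move=> df cN lip Nx Nt mu0 dir t0 tpb Lt1 Lt2.
have [hdir _] := is_direction_bounds mu0 dir.
have [model disp] := trial_displacement dir t0 tpb.
have := lipschitz_grad_upper_bound df cN lip Nx Nt.
rewrite /suff_decrease /objective -/pb in hdir model disp *.
set G := enorm (Gmap x p t) ^+ 2 in model disp *.
set Q := enorm pb ^+ 2 in hdir disp *.
set D := enorm (trial x p t - x) ^+ 2 in disp *.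
move=> upper.
have G0 : 0 <= G by exact: sqr_ge0.
have Q0 : 0 <= Q by exact: sqr_ge0.
have LD : `|L| * D <= t * (`|L| * t * Q + `|L| * t * G).
  apply: (le_trans (ler_wpM2l (normr_ge0 _) disp)).
  by rewrite le_eqVlt; apply/orP; left; apply/eqP; ring.
have LQ : `|L| * t * Q <= (1 - sigma) * ((1 - tau) * mu x) * Q by rewrite ler_wpM2r.
have LG : `|L| * t * G <= (1 - sigma) * G by rewrite ler_wpM2r.
have tLD : t * (`|L| * t * Q + `|L| * t * G) <=
    t * ((1 - sigma) * ((1 - tau) * mu x) * Q + (1 - sigma) * G).
  by rewrite ler_pM2l// lerD.
have thdir := hdir; rewrite -(ler_pM2l t0) in thdir.
lra.
Qed.

(** The minimum is a weight k with k criticality <= (1 - tau) mu |pb|^2 + |G_t|^2, obtained from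
    [criticality_le_step]. *)
Lemma suff_decrease_criticality x p t (m M : R) :
    0 < m -> m <= mu x -> mu x <= M -> is_direction f gamma P x p ->
    0 < t -> t <= 1 -> suff_decrease f gamma P x p t ->
  sigma * t * Num.min 1 ((1 - tau) * m / (lamH + 2 * M) ^+ 2) * criticality x
    <= objective f gamma x - objective f gamma (trial x p t).
Proof.
move=> m0 mmu muM dir t0 t1; apply: le_trans.
have mu0 : 0 < mu x by exact: lt_le_trans mmu.
have crit := criticality_le_step mu0 dir t0 t1.
have [tau0 tau1] := andP (tm_tau01 P); have [sig0 sig1] := andP (tm_sigma01 P).
have lam0 := tm_lamH_gt0 P.
set k := Num.min _ _.
have den_gt0 : 0 < (lamH + 2 * M) ^+ 2 by rewrite exprn_gt0//; lra.
have k0 : 0 < k by rewrite lt_min ltr01 divr_gt0// mulr_gt0// subr_gt0.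
set G := enorm (Gmap x p t) ^+ 2 in crit *.
set Q := enorm _ ^+ 2 in crit *.
have G0 : 0 <= G by exact: sqr_ge0.
have Q0 : 0 <= Q by exact: sqr_ge0.
have kG : k * G <= G by rewrite ler_piMl// ge_min lexx.
have kQ : k * ((lamH + 2 * mu x) ^+ 2 * Q) <= (1 - tau) * mu x * Q.
  rewrite mulrA ler_wpM2r//.
  apply: (@le_trans _ _ (k * (lamH + 2 * M) ^+ 2)).
    by rewrite ler_pM2l// ler_pXn2r// ?nnegrE; lra.
  apply: (@le_trans _ _ ((1 - tau) * m)).
    by rewrite -ler_pdivlMr// ge_min lexx orbT.
  by rewrite ler_pM2l// subr_gt0.
have kcrit : k * criticality x <= (1 - tau) * mu x * Q + G.
  apply: (le_trans (ler_wpM2l (ltW k0) crit)); lra.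
have st0 : 0 < sigma * t by rewrite mulr_gt0.
rewrite -(ler_pM2l st0) in kcrit; lra.
Qed.

End Iteration.

(** * Lower bounds on the stepsize and on the decrease *)

Section Uniform_decrease.
Set Implicit Arguments.
Unset Strict Implicit.
Context {R : realType} {n : nat}.
Context (f : 'cV[R]_n -> R) (gamma : R) (P : tmap_param R) (gamma_gt0 : 0 < gamma).
Implicit Types (x p : 'cV[R]_n) (a M L : R).

Local Notation psi := (objective f gamma).

Lemma tmap_step_nonincreasing x p x' :
  tmap_step f gamma P x p x' -> psi x' <= psi x.
Proof.
move=> [_ [j [dec _ ->]]]; rewrite -subr_ge0; apply: le_trans dec.
have [tau0 tau1] := andP (tm_tau01 P); have [sig0 _] := andP (tm_sigma01 P).
have [beta0 _] := andP (tm_beta01 P).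
have mu0 : 0 <= mu f gamma P x by rewrite mulr_ge0 ?powR_ge0// ltW ?tm_c_gt0.
have tau1' : 0 <= 1 - tm_tau P by rewrite subr_ge0 ltW.
have st : 0 <= tm_sigma P * tm_beta P ^+ j by rewrite mulr_ge0 ?exprn_ge0 ?ltW.
apply: addr_ge0; apply: mulr_ge0; rewrite ?sqr_ge0//.
by apply: mulr_ge0 => //; exact: mulr_ge0.
Qed.

(** If j > 0, the rejected stepsize beta^(j-1) exceeds T, so the accepted one exceeds beta T. *)
Lemma tmap_step_stepsize_ge x p x' (T : R) :
    (forall j, tm_beta P ^+ j <= T -> suff_decrease f gamma P x p (tm_beta P ^+ j)) ->
    tmap_step f gamma P x p x' ->
  exists t, [/\ Num.min 1 (tm_beta P * T) <= t, t <= 1,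
                suff_decrease f gamma P x p t & x' = trial f gamma P x p t].
Proof.
move=> small [_ [j [dec minj ->]]]; have [beta0 beta1] := andP (tm_beta01 P).
exists (tm_beta P ^+ j); split => //; last by rewrite exprn_ile1 ?ltW.
case: j dec minj => [|j] _ minj; first by rewrite expr0 ge_min lexx.
rewrite ge_min exprS (ler_pM2l beta0); apply/orP; right; rewrite ltW// ltNge.
by apply/negP => bT; exact: (minj j (ltnSn j) (small j bT)).
Qed.

(** [eta] is fixed before the iterate and the direction, so the same decrease applies at every visit
    near the limit point. *)
Lemma uniform_decrease (N : set 'cV[R]_n) (L a M : R) :
    (forall z, differentiable f z) -> convex_set N ->
    (forall u v, N u -> N v -> enorm (grad f u - grad f v) <= L * enorm (u - v)) ->
    0 < a ->
  exists2 eta, 0 < eta & forall x p x', N x ->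
    (forall j, N (trial f gamma P x p (tm_beta P ^+ j))) ->
    a <= enorm (prox_residual f gamma x) ->
    \sum_(i < n) (`|grad f x i 0| + gamma) ^+ 2 <= M ->
    tmap_step f gamma P x p x' -> eta <= psi x - psi x'.
Proof.
move=> df cN lip a0.
have [tau0 tau1] := andP (tm_tau01 P); have [sig0 sig1] := andP (tm_sigma01 P).
have [beta0 beta1] := andP (tm_beta01 P); have c0 := tm_c_gt0 P.
have [del0 _] := andP (tm_delta01 P); have lam0 := tm_lamH_gt0 P.
have eps0 := tm_eps_gt0 P.
have tau1' : 0 < 1 - tm_tau P by rewrite subr_gt0.
have sig1' : 0 < 1 - tm_sigma P by rewrite subr_gt0.
(* [m] and [m'] will enclose [mu], as the criticality lies between a^2 and [M]. *)
pose m := tm_c P * (a ^+ 2) `^ (tm_delta P / 2).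
pose m' := tm_c P * M `^ (tm_delta P / 2).
have m0 : 0 < m by rewrite mulr_gt0// powR_gt0// exprn_gt0.
have tm0 : 0 < (1 - tm_tau P) * m by exact: mulr_gt0.
have m'0 : 0 <= m' by rewrite mulr_ge0 ?powR_ge0// ltW.
(* B bounds the norm of the I^- part of p; every stepsize below T satisfies the
   sufficient decrease condition. *)
pose B := Num.sqrt M / ((1 - tm_tau P) * m) + 1.
have B0 : 0 < B by rewrite ltr_wpDl// divr_ge0 ?sqrtr_ge0// ltW.
(* The added 1, here and in [B], keeps the divisors positive. *)
pose L1 := `|L| + 1.
have L10 : 0 < L1 by rewrite ltr_wpDl.
(* The first quotient ensures t |pb| <= eps_k; the other two give the bounds on |L| t. *)
pose T := Num.min (Num.min (tm_eps P) a / B)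
  (Num.min ((1 - tm_sigma P) * ((1 - tm_tau P) * m) / L1) ((1 - tm_sigma P) / L1)).
have epsa0 : 0 < Num.min (tm_eps P) a by rewrite lt_min eps0.
have T0 : 0 < T.
  by rewrite lt_min divr_gt0// lt_min !divr_gt0// mulr_gt0.
pose t0 := Num.min 1 (tm_beta P * T).
have t00 : 0 < t0 by rewrite lt_min ltr01 mulr_gt0.
pose k := Num.min 1 ((1 - tm_tau P) * m / (tm_lamH P + 2 * m') ^+ 2).
have k0 : 0 < k.
  by rewrite lt_min ltr01 divr_gt0// exprn_gt0// ltr_pwDl// mulr_ge0.
(* Smallest stepsize [t0], weight [k] and lower bound a^2 on the criticality. *)
exists (tm_sigma P * t0 * k * a ^+ 2); first by rewrite !mulr_gt0 ?exprn_gt0.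
move=> x p x' Nx Nt ax gM step; have [dir _] := step.
have acrit : a ^+ 2 <= criticality f gamma P x.
  apply: le_trans (sqr_prox_residual_le_criticality f P gamma_gt0 x).
  by rewrite ler_pXn2r// nnegrE ?enorm_ge0 ?ltW.
have critM : criticality f gamma P x <= M.
  exact: le_trans (criticality_le f P gamma_gt0 x) gM.
have M0 : 0 <= M by apply: le_trans critM; apply: le_trans acrit; exact: sqr_ge0.
have crit0 : 0 <= criticality f gamma P x by apply: le_trans acrit; exact: sqr_ge0.
have mmu : m <= mu f gamma P x.
  by rewrite ler_pM2l// ge0_ler_powR ?nnegrE ?sqr_ge0// divr_ge0 ?ltW.
have mum' : mu f gamma P x <= m'.
  by rewrite ler_pM2l// ge0_ler_powR ?nnegrE// divr_ge0 ?ltW.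
have mu0 : 0 < mu f gamma P x by exact: lt_le_trans mmu.
(* Divide (1 - tau) m |pb|^2 <= <gw, pb> <= sqrt(M) |pb| by |pb|. *)
have pB : enorm (subvec (Defs.Im f gamma P x) p) <= B.
  have [dot_ge _] := is_direction_bounds mu0 dir.
  set pb := subvec _ p in dot_ge *; set gw := subvec _ _ in dot_ge.
  have gwM : enorm gw <= Num.sqrt M.
    rewrite -(@ler_pXn2r R 2) ?nnegrE ?enorm_ge0 ?sqrtr_ge0// (sqr_sqrtr M0).
    by apply: le_trans critM; rewrite lerDr sqr_ge0.
  have [->|pb_neq0] := eqVneq (enorm pb) 0; first exact: ltW.
  have pb0 : 0 < enorm pb by rewrite lt_neqAle eq_sym pb_neq0 enorm_ge0.
  apply: (@le_trans _ _ (Num.sqrt M / ((1 - tm_tau P) * m))); last by rewrite lerDl.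
  rewrite (ler_pdivlMr _ _ tm0) -(ler_pM2r pb0).
  apply: (@le_trans _ _ (enorm gw * enorm pb)); last by rewrite ler_pM2r.
  apply: le_trans (dotv_le_enorm gw pb); apply: le_trans dot_ge.
  have : (1 - tm_tau P) * m * enorm pb ^+ 2
      <= (1 - tm_tau P) * mu f gamma P x * enorm pb ^+ 2.
    by rewrite ler_wpM2r ?sqr_ge0// ler_pM2l.
  lra.
have small j : tm_beta P ^+ j <= T ->
    suff_decrease f gamma P x p (tm_beta P ^+ j).
  have := exprn_gt0 j beta0; move: (Nt j).
  move: (tm_beta P ^+ j) => t Ntx t_gt0.
  rewrite !le_min !ler_pdivlMr// => /and3P[tB tL1 tL2].
  have tL : `|L| * t <= t * L1 by rewrite mulrC ler_pM2l// lerDl.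
  apply: (suff_decrease_small_step gamma_gt0 df cN lip) => //.
  - apply: (@le_trans _ _ (t * B)); first by rewrite ler_pM2l.
    apply: (le_trans tB); rewrite /eps_at le_min ge_min lexx/= ge_min.
    by rewrite ax orbT.
  - apply: (le_trans tL); apply: (le_trans tL1).
    by rewrite ler_pM2l// ler_pM2l.
  - exact: le_trans tL tL2.
have [t [tt0 t1 dec ->]] := tmap_step_stepsize_ge small step.
have t_gt0 : 0 < t by exact: lt_le_trans tt0.
have := suff_decrease_criticality gamma_gt0 m0 mmu mum' dir t_gt0 t1 dec.
apply: le_trans; apply: ler_pM => //; first by rewrite !mulr_ge0 ?ltW.
  exact: sqr_ge0.
by rewrite ler_pM2r// ler_pM2l.
Qed.

End Uniform_decrease.

(** * Bounds near a nonstationary point *)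

Section Continuity.
Set Implicit Arguments.
Unset Strict Implicit.
Context {R : realType} {n : nat}.
Implicit Types (f : 'cV[R]_n -> R) (gamma : R).

Lemma soft_continuous gamma : continuous (soft gamma : R -> R).
Proof.
move=> a; apply: cvgD.
  apply: (@continuous_max R R^o (fun b => b - gamma) (cst 0)); last exact: cvg_cst.
  by apply: cvgB; [exact: cvg_id | exact: cvg_cst].
apply: (@continuous_min R R^o (fun b => b + gamma) (cst 0)); last exact: cvg_cst.
by apply: cvgD; [exact: cvg_id | exact: cvg_cst].
Qed.

Lemma grad_coord_continuous f i : continuous (grad f) ->
  continuous (fun x => grad f x i 0).
Proof.
move=> cg x; apply: (@continuous_comp _ _ _ (grad f) (fun v => v i 0)).
  exact: cg.
exact: coord_continuous.
Qed.

Lemma objective_continuous f gamma : (forall x, differentiable f x) ->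
  continuous (objective f gamma).
Proof.
move=> df x; apply: (@cvgD _ _ _ (nbhs x)); first exact: (differentiable_continuous (df x)).
apply: (@cvgM _ _ (nbhs x)); first exact: cvg_cst.
apply: cvg_big => [|i _]; first exact: add_continuous.
by apply: cvg_norm; exact: coord_continuous.
Qed.

(** A nonzero residual coordinate at x keeps half its size nearby, and each gradient coordinate
    grows by less than 1. *)
Lemma near_nonstationary f gamma x : 0 < gamma -> continuous (grad f) ->
    ~ stationary f (l1reg gamma) x ->
  exists a M, 0 < a /\ \forall y \near x,
    a <= enorm (prox_residual f gamma y) /\
    \sum_(i < n) (`|grad f y i 0| + gamma) ^+ 2 <= M.
Proof.
move=> gamma_gt0 cg nst.
have [i resi] : exists i, prox_residual f gamma x i 0 != 0.
  apply/existsP; apply: contra_notT nst => /existsPn res0.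
  apply: prox_residual0_stationary => //; apply/matrixP => i j.
  by rewrite ord1 [RHS]mxE; apply/eqP; have := res0 i; rewrite negbK.
pose r (y : 'cV[R]_n) := y i 0 - soft gamma (y i 0 - grad f y i 0).
have cr : r y @[y --> x] --> r x.
  apply: (@cvgB _ _ _ (nbhs x)); first exact: coord_continuous.
  apply: continuous_cvg; first exact: soft_continuous.
  by apply: (@cvgB _ _ _ (nbhs x)); [exact: coord_continuous | exact: grad_coord_continuous].
have rx : 0 < `|r x| by rewrite normr_gt0 /r -prox_residualE.
exists (`|r x| / 2), (\sum_(i < n) (`|grad f x i 0| + 1 + gamma) ^+ 2).
split; first by rewrite divr_gt0.
have near_r : \forall y \near x, `|r x| / 2 < `|r y|.
  by apply: (cvgr_gt _ (cvg_norm cr)); lra.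
have near_g : \forall y \near x, forall j, `|grad f y j 0| < `|grad f x j 0| + 1.
  apply: (@filter_forall _ _ _ (nbhs x)) => j.
  have cgj : `|grad f y j 0| @[y --> x] --> `|grad f x j 0|.
    by apply: (@cvg_norm _ _ _ (nbhs x)); exact: grad_coord_continuous.
  by apply: (cvgr_lt _ cgj); rewrite ltrDl.
near=> y; split.
  apply: le_trans _ (enorm_coord_le (prox_residual f gamma y) i).
  rewrite (prox_residualE f gamma_gt0 y i).
  by apply: ltW; near: y.
apply: ler_sum => j _; rewrite ler_pXn2r ?nnegrE ?addr_ge0 ?(ltW gamma_gt0)//.
rewrite lerD2r; apply: ltW; move: j; near: y; exact: near_g.
Unshelve. all: by end_near. Qed.

End Continuity.

Theorem theorem4p2 (R : realType) (n : nat) (f : 'cV[R]_n -> R) (gamma : R)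
    (P : tmap_param R) (x0 : 'cV[R]_n) (x p : nat -> 'cV[R]_n)
    (N : set 'cV[R]_n) (Lg : R)
    (gamma_gt0 : 0 < gamma)
    (f_diff : forall y, differentiable f y)
    (grad_cont : continuous (grad f))
    (run : tmap_run f gamma P x0 x p)
    (sublevel_bounded : forall a : R, bounded_set (sublevel f gamma a))
    (N_open : open N)
    (N_convex : convex_set N)
    (N_sublevel : sublevel f gamma (objective f gamma x0) `<=` N)
    (N_trial : trial_points f gamma P x p `<=` N)
    (grad_lipschitz : forall y z, N y -> N z ->
       enorm (grad f y - grad f z) <= Lg * enorm (y - z))
    (nonstationary : forall k, ~ stationary f (l1reg gamma) (x k)) :
  forall xstar : 'cV[R]_n, cluster (x @ \oo) xstar ->
    stationary f (l1reg gamma) xstar.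
Proof.
move=> xstar clus; apply: contrapT => nst.
have [xE steps] := run.
have [a [M [a0 near_x]]] := near_nonstationary gamma_gt0 grad_cont nst.
have [eta eta0 dec] :=
  uniform_decrease P gamma_gt0 M f_diff N_convex grad_lipschitz a0.
have mono k l : (k <= l)%N -> objective f gamma (x l) <= objective f gamma (x k).
  move=> /subnKC <-; elim: (l - k)%N => [|d IH]; first by rewrite addn0.
  by rewrite addnS; apply: le_trans IH; exact: tmap_step_nonincreasing (steps _).
have Nx k : N (x k) by apply: N_sublevel; rewrite /sublevel/= -xE; exact: mono.
have cpsi := @objective_continuous _ _ f gamma f_diff xstar.
have near_up : \forall y \near xstar,
    objective f gamma y < objective f gamma xstar + eta / 2.
  by apply: (cvgr_lt _ cpsi); rewrite ltrDl divr_gt0.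
have near_dn : \forall y \near xstar,
    objective f gamma xstar - eta / 2 < objective f gamma y.
  by apply: (cvgr_gt _ cpsi); rewrite ltrBlDr ltrDl divr_gt0.
(* Clustering, applied to the tail of the sequence, gives visits of arbitrarily large index. *)
have visit K (V : set 'cV[R]_n) : nbhs xstar V -> exists2 k, (K <= k)%N & V (x k).
  move=> nV.
  have tail : (x @ \oo) [set y | exists2 k, (K <= k)%N & y = x k].
    by exists K => // k /= Kk; exists k.
  by have [y [[k Kk ->] Vk]] := clus _ _ tail nV; exists k.
have [k _ [[resk gk] psik]] := visit 0%N _ (filterI near_x near_up).
(* The second visit starts at [k.+1], so monotonicity gives psi(x_l) <= psi(x_{k+1}) <= psi(x_k) -
   eta. *)
have [l kl psil] := visit k.+1 _ near_dn.
have Nt j : N (trial f gamma P (x k) (p k) (tm_beta P ^+ j)).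
  by apply: N_trial; exists k, j.
have := dec _ _ _ (Nx k) Nt resk gk (steps k).
have := mono _ _ kl; move: psik psil => /=; lra.
Qed.
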